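(* Let $f\colon A\to B$ be a morphism of commutative differential graded algebras over a field $\mathbf k$ of characteristic zero. Then the pull-back $\mathcal J_{\overline\bullet}(f)$, with product and differential defined componentwise, is a coperverse cdga.
   Context: $\mathcal{P}_n^{op}$ is the set $\{0,1,\dots,2n-2\}$ with the reverse of the usual order (so $\overline p\le\overline q$ in $\mathcal{P}_n^{op}$ means $p\ge q$ as integers). A coperverse cdga over $\mathbf k$ is a functor $\mathcal P_n^{op}\to\mathsf{CDGA}_{\mathbf k}$; i.e. a family of non-negatively graded cdga's $A_{\overline p}$ with poset maps $\varphi_{\overline p,\overline q}\colon A_{\overline p}\to A_{\overline q}$ for $\overline p\le\overline q$, compatible with products and differentials. For a cdga $B$ put $B(t,dt)=B\otimes\wedge(t,dt)$ with $|t|=0$, $|dt|=1$, $d(t)=dt$, and let $\delta_1\colon B(t,dt)\to B$ be evaluation at $t=1$, $dt=0$. Let $C_{\overline p}\subset B^p$ be the image of a chosen section of $B^p\to B^p/\ker d^p$. Define $\xi^{\overline p}B(t,dt)$ in degree $r$ by: $B^r\otimes\mathbf k[t]t\oplus B^{r-1}\otimes\mathbf k[t]dt$ if $r<p$; $B^{p-1}\otimes\mathbf k[t]dt\oplus B^p\otimes\mathbf k[t]t\oplus C_{\overline p}$ if $r=p$; $B^{r-1}\otimes\mathbf k[t]dt\oplus B^r\otimes\mathbf k[t]$ if $r>p$. The unital $\overline p$-cotruncation is $\xi_+^{\overline p}B(t,dt)=B^0\oplus\xi^{\overline p}B(t,dt)$. For $\overline p\in\mathcal P_n^{op}$, $\mathcal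 J_{\overline p}(f)$ is the pull-back, in $\mathsf{CDGA}_{\mathbf k}$, of $A\xrightarrow{f}B\xleftarrow{\delta_1}\xi_+^{\overline p}B(t,dt)$; the poset maps are induced by the inclusions of the cotruncations $\xi_+^{\overline p}B(t,dt)\to\xi_+^{\overline q}B(t,dt)$ for $\overline p\le\overline q$ in $\mathcal P_n^{op}$.
   Formalization: Added when some p > 0 exists: d = 0 on B^0, and for p > 0 the chosen section of B^p → B^p/ker d^p is B^0-linear. Without these the unital cotruncations and the pull-back are not closed under differential and product. The zero algebra is excluded. *)

(* Defs.v *)
From HB Require Import structures.
From mathcomp Require Import all_boot all_order all_algebra.

Set Implicit Arguments.
Unset Strict Implicit.
Unset Printing Implicit Defensive.

Import GRing.Theory.
Local Open Scope ring_scope.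

(* A non-negatively graded cdga, given by the total algebra A = \bigoplus_n A^n
   and the projections [hcomp n] of A onto its summands A^n. *)
HB.mixin Record isCDGA (k : fieldType) A of GRing.Algebra k A := {
  hcomp : nat -> A -> A;
  diff : A -> A;
  hcomp_is_linear : forall n, linear (hcomp n);
  hcomp_proj : forall m n x,
    hcomp m (hcomp n x) = if m == n then hcomp n x else 0;
  hcomp_sum : forall x, exists N, x == \sum_(i < N) hcomp i x;
  hcomp1 : hcomp 0 1 = 1;
  hcompM : forall m n x y, hcomp m x = x -> hcomp n y = y ->
    hcomp (m + n)%N (x * y) = x * y;
  gcommM : forall m n x y, hcomp m x = x -> hcomp n y = y ->
    x * y = (-1) ^+ (m * n)%N *: (y * x);
  diff_is_linear : linear diff;
  diff_hcomp : forall n x, hcomp n x = x -> hcomp n.+1 (diff x) = diff x;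
  diffK : forall x, diff (diff x) = 0;
  diffM : forall n x y, hcomp n x = x ->
    diff (x * y) = diff x * y + (-1) ^+ n *: (x * diff y) }.

#[short(type="cdgaType")]
HB.structure Definition CDGA (k : fieldType) :=
  { A of GRing.Algebra k A & isCDGA k A }.

Arguments hcompM {k s m n x y}.
Arguments gcommM {k s m n x y}.
Arguments diff_hcomp {k s n x}.
Arguments diffM {k s n x} y.

Definition homog (k : fieldType) (A : cdgaType k) (n : nat) : {pred A} :=
  [pred x | hcomp n x == x].
Arguments homog {k A} n.

HB.mixin Record isCDGAHom (k : fieldType) (A B : cdgaType k) (f : A -> B) := {
  hom_hcomp : forall n x, f (hcomp n x) = hcomp n (f x);
  hom_diff : forall x, f (diff x) = diff (f x) }.

#[short(type="cdgaHom")]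
HB.structure Definition CDGAHom (k : fieldType) (A B : cdgaType k) :=
  { f of @GRing.LRMorphism k A B *:%R f & @isCDGAHom k A B f }.

Section GradedTheory.
Variables (k : fieldType) (A : cdgaType k).
Implicit Types (x y : A) (m n : nat).

HB.instance Definition _ n :=
  GRing.isLinear.Build k A A *:%R (@hcomp k A n) (hcomp_is_linear n).
HB.instance Definition _ :=
  GRing.isLinear.Build k A A *:%R (@diff k A) diff_is_linear.

Lemma homogP n x : reflect (hcomp n x = x) (x \in homog n).
Proof. exact: eqP. Qed.

Lemma hcompK n x : hcomp n (hcomp n x) = hcomp n x.
Proof. by rewrite hcomp_proj eqxx. Qed.

Lemma hcomp_eq x y : (forall n, hcomp n x = hcomp n y) -> x = y.
Proof.
move=> e; have [N /eqP xE] := hcomp_sum (x - y).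
apply/eqP; rewrite -subr_eq0 xE big1 // => i _.
by rewrite linearB /= e subrr.
Qed.

Lemma hcomp_homog m n x : hcomp n x = x ->
  hcomp m x = if m == n then x else 0.
Proof. by move=> <-; rewrite hcomp_proj. Qed.

(* The grading involution x |-> (-1)^|x| x, which carries the Koszul signs. *)
Definition gsign x : A :=
  \sum_(i < ex_minn (hcomp_sum x)) (-1) ^+ i *: hcomp i x.

Lemma hcomp_gsign n x : hcomp n (gsign x) = (-1) ^+ n *: hcomp n x.
Proof.
rewrite /gsign; case: ex_minnP => N /eqP xE _.
rewrite [in RHS]xE !linear_sum /=; apply: eq_bigr => i _.
rewrite linearZ /= hcomp_proj; case: eqP => [->//|_].
by rewrite !scaler0.
Qed.

Lemma gsign_is_linear : linear gsign.
Proof.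
move=> a x y; apply: hcomp_eq => n.
rewrite hcomp_gsign !linearP /= !hcomp_gsign.
by rewrite ?scalerDr !scalerA mulrC.
Qed.
HB.instance Definition _ :=
  GRing.isLinear.Build k A A *:%R gsign gsign_is_linear.

Lemma gsign_homog n x : hcomp n x = x -> gsign x = (-1) ^+ n *: x.
Proof.
move=> xn; apply: hcomp_eq => m.
rewrite hcomp_gsign linearZ /= (hcomp_homog m xn).
by case: eqP => [->|_]; rewrite ?scaler0.
Qed.

Lemma gsign_is_monoid_morphism : monoid_morphism gsign.
Proof.
split; first by rewrite (gsign_homog hcomp1) scale1r.
move=> x y; have [M /eqP xE] := hcomp_sum x; have [N /eqP yE] := hcomp_sum y.
rewrite xE yE big_distrlr /= !linear_sum big_distrlr /=.
apply: eq_bigr => i _; rewrite linear_sum; apply: eq_bigr => j _ /=.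
rewrite (gsign_homog (hcompM (hcompK i x) (hcompK j y))).
rewrite !(gsign_homog (hcompK _ _)) exprD -scalerA.
by rewrite -scalerAl -scalerAr.
Qed.
HB.instance Definition _ :=
  GRing.isMonoidMorphism.Build A A gsign gsign_is_monoid_morphism.

Lemma diff_gsign x : diff (gsign x) = - gsign (diff x).
Proof.
have [N /eqP ->] := hcomp_sum x.
rewrite (linear_sum gsign) !(linear_sum (@diff k A)) (linear_sum gsign) -sumrN.
apply: eq_bigr => i _ /=.
rewrite (gsign_homog (hcompK _ _)) linearZ /=.
rewrite (gsign_homog (diff_hcomp (hcompK _ _))).
by rewrite exprS mulN1r scaleNr opprK.
Qed.

Lemma gsignK x : gsign (gsign x) = x.
Proof.
by apply: hcomp_eq => n; rewrite !hcomp_gsign scalerA -expr2 sqrr_sign scale1r.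
Qed.

Lemma diff_mul x y : diff (x * y) = diff x * y + gsign x * diff y.
Proof.
have [N /eqP ->] := hcomp_sum x.
rewrite mulr_suml !linear_sum /= !mulr_suml -big_split /=.
apply: eq_bigr => i _; rewrite (diffM _ (hcompK _ _)).
by rewrite (gsign_homog (hcompK _ _)) scalerAl.
Qed.

End GradedTheory.

(* [Tdt P Q] is the element P + Q dt of B(t,dt) = B \otimes \wedge(t,dt), with
   P, Q in B \otimes k[t] = B[t]; [\poly_i b_i] encodes \sum_i b_i \otimes t^i.
   The Koszul rule dt b = (-1)^|b| b dt gives the product below, and
   d (b t^i) = (d b) t^i + (-1)^|b| b d(t^i) gives the differential. *)
Record tdt (k : fieldType) (B : cdgaType k) :=
  Tdt { tpart : {poly B}; dtpart : {poly B} }.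
Arguments Tdt {k B} tpart dtpart.

Section Tdt.
Variables (k : fieldType) (B : cdgaType k).
Implicit Types (v w : tdt B) (P Q : {poly B}) (r : nat).

Let to_pair w := (tpart w, dtpart w).
Let of_pair (u : {poly B} * {poly B}) : tdt B := Tdt u.1 u.2.
Let to_pairK : cancel to_pair of_pair. Proof. by case. Qed.
HB.instance Definition _ := Choice.copy (tdt B) (can_type to_pairK).

Lemma tdt_eq v w : tpart v = tpart w -> dtpart v = dtpart w -> v = w.
Proof. by case: v w => [P Q] [P' Q'] /= -> ->. Qed.

Definition tdt0 : tdt B := Tdt 0 0.
Definition tdt_opp w := Tdt (- tpart w) (- dtpart w).
Definition tdt_add v w := Tdt (tpart v + tpart w) (dtpart v + dtpart w).
Definition tdt1 : tdt B := Tdt 1 0.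
Definition tdt_mul v w := Tdt (tpart v * tpart w)
  (tpart v * dtpart w + dtpart v * map_poly (@gsign k B) (tpart w)).
Definition tdt_scale (c : k) w := Tdt (c%:A *: tpart w) (c%:A *: dtpart w).

Fact tdt_addA : associative tdt_add.
Proof. by move=> u v w; apply: tdt_eq; rewrite /= addrA. Qed.
Fact tdt_addC : commutative tdt_add.
Proof. by move=> v w; apply: tdt_eq; rewrite /= addrC. Qed.
Fact tdt_add0 : left_id tdt0 tdt_add.
Proof. by move=> w; apply: tdt_eq; rewrite /= add0r. Qed.
Fact tdt_addN : left_inverse tdt0 tdt_opp tdt_add.
Proof. by move=> w; apply: tdt_eq; rewrite /= addNr. Qed.
HB.instance Definition _ := GRing.isZmodule.Build (tdt B)
  tdt_addA tdt_addC tdt_add0 tdt_addN.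

Fact tdt_mulA : associative tdt_mul.
Proof.
move=> u v w; apply: tdt_eq; rewrite /= ?mulrA //.
by rewrite rmorphM mulrDr mulrDl !mulrA addrA.
Qed.
Fact tdt_mul1l : left_id tdt1 tdt_mul.
Proof. by move=> w; apply: tdt_eq; rewrite /= !mul1r ?mul0r ?addr0. Qed.
Fact tdt_mul1r : right_id tdt1 tdt_mul.
Proof.
by move=> w; apply: tdt_eq; rewrite /= ?rmorph1 ?mulr1 // mulr0 add0r.
Qed.
Fact tdt_mulDl : left_distributive tdt_mul tdt_add.
Proof. by move=> u v w; apply: tdt_eq; rewrite /= !mulrDl // addrACA. Qed.
Fact tdt_mulDr : right_distributive tdt_mul tdt_add.
Proof.
by move=> u v w; apply: tdt_eq; rewrite /= ?rmorphD !mulrDr // addrACA.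
Qed.
Fact tdt1_neq0 : tdt1 != tdt0.
Proof. by apply/eqP => -[/eqP]; rewrite oner_eq0. Qed.
HB.instance Definition _ := GRing.Zmodule_isNzRing.Build (tdt B)
  tdt_mulA tdt_mul1l tdt_mul1r tdt_mulDl tdt_mulDr tdt1_neq0.

Fact tdt_scaleA a b w : tdt_scale a (tdt_scale b w) = tdt_scale (a * b) w.
Proof.
by apply: tdt_eq; rewrite /= scalerA -scalerAl mul1r scalerA.
Qed.
Fact tdt_scale1 : left_id 1 tdt_scale.
Proof. by move=> w; apply: tdt_eq; rewrite /= !scale1r. Qed.
Fact tdt_scaleDr : right_distributive tdt_scale +%R.
Proof. by move=> a v w; apply: tdt_eq; rewrite /= scalerDr. Qed.
Fact tdt_scaleDl w : {morph tdt_scale^~ w : a b / a + b}.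
Proof. by move=> a b; apply: tdt_eq; rewrite /= !scalerDl. Qed.
HB.instance Definition _ := GRing.Zmodule_isLmodule.Build k (tdt B)
  tdt_scaleA tdt_scale1 tdt_scaleDr tdt_scaleDl.

Lemma polyA_coef (c : k) P i : (c%:A *: P)`_i = c *: P`_i.
Proof. by rewrite coefZ -scalerAl mul1r. Qed.

Lemma polyA_mull (c : k) P Q : c%:A *: (P * Q) = (c%:A *: P) * Q.
Proof. by rewrite scalerAl. Qed.

Lemma polyA_mulr (c : k) P Q : c%:A *: (P * Q) = P * (c%:A *: Q).
Proof.
apply/polyP=> i; rewrite polyA_coef !coefM scaler_sumr.
by apply: eq_bigr => j _; rewrite polyA_coef scalerAr.
Qed.

Lemma polyA_map (g : {linear B -> B}) (c : k) P :
  map_poly g (c%:A *: P) = c%:A *: map_poly g P.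
Proof.
by apply/polyP=> i; rewrite polyA_coef !coef_map /= polyA_coef linearZ.
Qed.

Fact tdt_scaleAl (a : k) v w : a *: (v * w) = (a *: v) * w.
Proof. by apply: tdt_eq; rewrite /= ?scalerDr !polyA_mull. Qed.
HB.instance Definition _ := GRing.Lmodule_isLalgebra.Build k (tdt B) tdt_scaleAl.

Fact tdt_scaleAr (a : k) v w : a *: (v * w) = v * (a *: w).
Proof.
by apply: tdt_eq; rewrite /= ?polyA_map ?scalerDr !polyA_mulr.
Qed.
HB.instance Definition _ := GRing.Lalgebra_isAlgebra.Build k (tdt B) tdt_scaleAr.

Definition tdt_hcomp r w : tdt B :=
  Tdt (map_poly (@hcomp k B r) (tpart w))
      (if r is r'.+1 then map_poly (@hcomp k B r') (dtpart w) else 0).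

Definition tdt_diff w : tdt B :=
  Tdt (map_poly (@diff k B) (tpart w))
      (map_poly (@diff k B) (dtpart w) + map_poly (@gsign k B) (tpart w)^`()).

Lemma map_poly_hcompP r P :
  map_poly (@hcomp k B r) P = P <-> forall i, hcomp r P`_i = P`_i.
Proof.
split=> [PE i|h]; first by rewrite -[in RHS]PE coef_map.
by apply/polyP=> i; rewrite coef_map /= h.
Qed.

Lemma tdt_hcompP r w : tdt_hcomp r w = w ->
  map_poly (@hcomp k B r) (tpart w) = tpart w /\
  (if r is r'.+1 then map_poly (@hcomp k B r') (dtpart w) else 0) = dtpart w.
Proof. by move=> e; rewrite -{2 4}e. Qed.

Lemma map_hcompM m n P Q :
    map_poly (@hcomp k B m) P = P -> map_poly (@hcomp k B n) Q = Q ->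
  map_poly (@hcomp k B (m + n)%N) (P * Q) = P * Q.
Proof.
move=> /map_poly_hcompP hP /map_poly_hcompP hQ; apply/map_poly_hcompP=> i.
rewrite coefM linear_sum; apply: eq_bigr => j _ /=; exact: hcompM.
Qed.

Lemma map_gcommM m n P Q :
    map_poly (@hcomp k B m) P = P -> map_poly (@hcomp k B n) Q = Q ->
  P * Q = ((-1) ^+ (m * n)%N)%:A *: (Q * P).
Proof.
move=> /map_poly_hcompP hP /map_poly_hcompP hQ; apply/polyP=> i.
rewrite polyA_coef coefM coefMr scaler_sumr.
by apply: eq_bigr => j _; rewrite -gcommM.
Qed.

Lemma map_gsign n P : map_poly (@hcomp k B n) P = P ->
  map_poly (@gsign k B) P = ((-1) ^+ n)%:A *: P.
Proof.
move=> /map_poly_hcompP hP; apply/polyP=> i.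
by rewrite coef_map polyA_coef /= (gsign_homog (hP i)).
Qed.

Lemma map_diffM P Q : map_poly (@diff k B) (P * Q) =
  map_poly (@diff k B) P * Q + map_poly (@gsign k B) P * map_poly (@diff k B) Q.
Proof.
apply/polyP=> i; rewrite coef_map coefD !coefM /= linear_sum -big_split /=.
by apply: eq_bigr => j _; rewrite diff_mul !coef_map.
Qed.

Fact tdt_hcomp_is_linear r : linear (tdt_hcomp r).
Proof.
move=> a v w; apply: tdt_eq; rewrite /= ?raddfD /= ?polyA_map //.
by case: r => [|r] /=; rewrite ?raddfD /= ?polyA_map // ?scaler0 ?addr0.
Qed.

Fact tdt_hcomp_proj m n w :
  tdt_hcomp m (tdt_hcomp n w) = if m == n then tdt_hcomp n w else 0.
Proof.
have mapE i j P : map_poly (@hcomp k B i) (map_poly (@hcomp k B j) P) =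
    if i == j then map_poly (@hcomp k B j) P else 0.
  apply/polyP=> l; rewrite !coef_map /= hcomp_proj.
  by case: eqP; rewrite ?coef0 ?coef_map.
apply: tdt_eq; first by rewrite /= mapE; case: eqP.
by case: m n => [|m] [|n] //=; rewrite ?raddf0 // ?mapE ?eqSS; case: eqP.
Qed.

Lemma map_hcomp_sum P : exists N, forall M, (N <= M)%N ->
  P = \sum_(i < M) map_poly (@hcomp k B i) P.
Proof.
have bnd x : exists N, forall M, (N <= M)%N -> x = \sum_(i < M) @hcomp k B i x.
  have [N /eqP xE] := hcomp_sum x; exists N => M leNM.
  rewrite -(subnKC leNM) big_split_ord /= -xE big1 ?addr0 // => i _.
  rewrite xE linear_sum big1 // => j _ /=; rewrite hcomp_proj.
  by case: eqP => // e; have := ltn_ord j; rewrite -e ltnNge leq_addr.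
elim/poly_ind: P => [|P c [N hN]].
  by exists 0%N => M _; rewrite big1 // => i _; rewrite raddf0.
have [N' hN'] := bnd c; exists (maxn N N') => M; rewrite geq_max => /andP[h h'].
apply/polyP=> j; rewrite coef_sum.
under eq_bigr do rewrite coef_map /= coefD coefMX coefC.
rewrite coefD coefMX coefC; case: j => [|j] /=; last first.
  rewrite addr0 [in LHS](hN _ h) coef_sum.
  by apply: eq_bigr => i _; rewrite coef_map.
by rewrite add0r; apply: hN'.
Qed.

Lemma tpart_sum I (s : seq I) (F : I -> tdt B) :
  tpart (\sum_(i <- s) F i) = \sum_(i <- s) tpart (F i).
Proof. by elim/big_rec2: _ => [//|i v w _ <-]. Qed.
Lemma dtpart_sum I (s : seq I) (F : I -> tdt B) :
  dtpart (\sum_(i <- s) F i) = \sum_(i <- s) dtpart (F i).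
Proof. by elim/big_rec2: _ => [//|i v w _ <-]. Qed.

Fact tdt_hcomp_sum w : exists N, w == \sum_(i < N) tdt_hcomp i w.
Proof.
have [N hN] := map_hcomp_sum (tpart w).
have [N' hN'] := map_hcomp_sum (dtpart w).
exists (maxn N N').+1; apply/eqP/tdt_eq.
  by rewrite tpart_sum; apply: hN; rewrite leqW // leq_maxl.
by rewrite dtpart_sum big_ord_recl /= add0r; apply: hN'; rewrite leq_maxr.
Qed.

Fact tdt_hcomp1 : tdt_hcomp 0 1 = 1.
Proof. by apply: tdt_eq => //=; rewrite map_polyC /= hcomp1. Qed.

Fact tdt_hcompM m n v w : tdt_hcomp m v = v -> tdt_hcomp n w = w ->
  tdt_hcomp (m + n)%N (v * w) = v * w.
Proof.
move=> /tdt_hcompP[Pv Qv] /tdt_hcompP[Pw Qw].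
apply: tdt_eq => /=; first exact: map_hcompM.
rewrite (map_gsign Pw) -polyA_mulr.
case: m n Pv Qv Pw Qw => [|m] [|n] //= Pv Qv Pw Qw.
- by rewrite -Qv -Qw mulr0 mul0r scaler0 addr0.
- by rewrite -Qv mul0r scaler0 addr0 -[X in map_poly (hcomp X)]add0n map_hcompM.
- by rewrite -Qw mulr0 add0r polyA_map map_hcompM.
- rewrite raddfD /= polyA_map (map_hcompM Qv Pw).
  by rewrite -addSnnS (map_hcompM Pv Qw).
Qed.

Fact tdt_gcommM m n v w : tdt_hcomp m v = v -> tdt_hcomp n w = w ->
  v * w = (-1) ^+ (m * n)%N *: (w * v).
Proof.
move=> /tdt_hcompP[Pv Qv] /tdt_hcompP[Pw Qw].
apply: tdt_eq => /=; first exact: map_gcommM.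
rewrite (map_gsign Pw) (map_gsign Pv) -!polyA_mulr scalerDr addrC.
have AA (a b : k) P : a%:A *: (b%:A *: P) = (a * b)%:A *: P :> {poly B}.
  by rewrite scalerA -scalerAl mul1r scalerA.
rewrite AA; congr (_ + _).
- case: m Pv Qv => [|m] Pv Qv; first by rewrite -Qv mul0r mulr0 !scaler0.
  rewrite (map_gcommM Qv Pw) AA; congr (_%:A *: _).
  by rewrite -exprD mulSn addnC.
- case: n Pw Qw => [|n] Pw Qw; first by rewrite -Qw mul0r mulr0 !scaler0.
  rewrite (map_gcommM Pv Qw); congr (_%:A *: _).
  by rewrite -exprD mulnS addnC addnA -[RHS]signr_odd oddD addnn odd_double signr_odd.
Qed.

Fact tdt_diff_is_linear : linear tdt_diff.
Proof.
move=> a v w; apply: tdt_eq; rewrite /= ?raddfD /= ?polyA_map //.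
by rewrite derivZ polyA_map addrACA.
Qed.

Fact tdt_diff_hcomp n w : tdt_hcomp n w = w ->
  tdt_hcomp n.+1 (tdt_diff w) = tdt_diff w.
Proof.
move=> /tdt_hcompP[Pw Qw].
have dP m P : map_poly (@hcomp k B m) P = P ->
    map_poly (@hcomp k B m.+1) (map_poly (@diff k B) P) =
    map_poly (@diff k B) P.
  move=> /map_poly_hcompP hP; apply/map_poly_hcompP=> i.
  by rewrite coef_map /= diff_hcomp.
apply: tdt_eq => /=; first exact: dP.
rewrite raddfD /=; congr (_ + _).
  by case: n Pw Qw => [|n] Pw Qw; [rewrite -Qw !raddf0 | rewrite dP].
have hD : map_poly (@hcomp k B n) (tpart w)^`() = (tpart w)^`().
  apply/map_poly_hcompP=> i; rewrite coef_deriv raddfMn /=.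
  by move/map_poly_hcompP: Pw => ->.
by rewrite (map_gsign hD) polyA_map hD.
Qed.

Fact tdt_diffK w : tdt_diff (tdt_diff w) = 0.
Proof.
have dd P : map_poly (@diff k B) (map_poly (@diff k B) P) = 0.
  by apply/polyP=> i; rewrite !coef_map /= diffK coef0.
apply: tdt_eq; rewrite /= ?dd // raddfD /= dd add0r.
apply/polyP=> i; rewrite coefD !coef_map !coef_deriv coef0 !coef_map /=.
by rewrite diff_gsign raddfMn /= addNr.
Qed.

Fact tdt_diffM n v w : tdt_hcomp n v = v ->
  tdt_diff (v * w) = tdt_diff v * w + (-1) ^+ n *: (v * tdt_diff w).
Proof.
move=> /tdt_hcompP[Pv Qv].
apply: tdt_eq => /=; first by rewrite map_diffM (map_gsign Pv) polyA_mull.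
have gdE : map_poly (@gsign k B) (dtpart v) *
    map_poly (@diff k B) (map_poly (@gsign k B) (tpart w)) =
    ((-1) ^+ n)%:A *: dtpart v *
    map_poly (@gsign k B) (map_poly (@diff k B) (tpart w)).
  have -> : map_poly (@diff k B) (map_poly (@gsign k B) (tpart w)) =
      - map_poly (@gsign k B) (map_poly (@diff k B) (tpart w)).
    by apply/polyP=> i; rewrite coefN !coef_map /= diff_gsign.
  case: n Pv Qv => [|n] Pv Qv; first by rewrite -Qv !raddf0 ?scaler0 !mul0r.
  rewrite (map_gsign Qv) mulrN -mulNr; congr (_ * _).
  by rewrite exprS mulN1r !scaleNr.
rewrite raddfD /= !map_diffM gdE derivM raddfD /= !rmorphM /=.
rewrite (map_gsign Pv) !mulrDl !mulrDr !scalerDr !polyA_mull !addrA.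
by rewrite [LHS](ACl (1*3*5*2*6*4)).
Qed.

HB.instance Definition _ := isCDGA.Build k (tdt B)
  tdt_hcomp_is_linear tdt_hcomp_proj tdt_hcomp_sum tdt_hcomp1 tdt_hcompM
  tdt_gcommM tdt_diff_is_linear tdt_diff_hcomp tdt_diffK tdt_diffM.

Definition delta1 (w : tdt B) : B := (tpart w).[1].

Lemma horner1_map (g : {linear B -> B}) P : (map_poly g P).[1] = g P.[1].
Proof.
have sumE Q : Q.[1] = \sum_(i < size Q) Q`_i.
  by rewrite horner_coef; apply: eq_bigr => i _; rewrite expr1n mulr1.
rewrite !sumE linear_sum /= (big_ord_widen _ _ (size_poly _ _)) big_mkcond.
apply: eq_bigr => i _; rewrite coef_map; case: ltnP => // le_i.
by rewrite -(coef_map g) nth_default.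
Qed.

Fact delta1_is_linear : linear delta1.
Proof. by move=> a v w; rewrite /delta1 /= hornerD hornerZ -scalerAl mul1r. Qed.
HB.instance Definition _ :=
  GRing.isLinear.Build k (tdt B) B *:%R delta1 delta1_is_linear.
Fact delta1_is_monoid_morphism : monoid_morphism delta1.
Proof.
split=> [|v w]; first by rewrite /delta1 /= hornerC.
by rewrite /delta1 /= hornerM_comm // /comm_poly mulr1 mul1r.
Qed.
HB.instance Definition _ :=
  GRing.isMonoidMorphism.Build (tdt B) B delta1 delta1_is_monoid_morphism.
Fact delta1_hcomp n w : delta1 (hcomp n w) = hcomp n (delta1 w).
Proof. by rewrite /delta1 /= horner1_map. Qed.
Fact delta1_diff w : delta1 (diff w) = diff (delta1 w).
Proof. by rewrite /delta1 /= horner1_map. Qed.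
HB.instance Definition _ :=
  isCDGAHom.Build k (tdt B) B delta1 delta1_hcomp delta1_diff.

End Tdt.

Section HomComp.
Variables (k : fieldType) (A B C : cdgaType k).
Variables (g : cdgaHom B C) (f : cdgaHom A B).

Fact comp_hcomp n x : (g \o f) (hcomp n x) = hcomp n ((g \o f) x).
Proof. by rewrite /= !hom_hcomp. Qed.
Fact comp_diff x : (g \o f) (diff x) = diff ((g \o f) x).
Proof. by rewrite /= !hom_diff. Qed.
HB.instance Definition _ :=
  isCDGAHom.Build k A C (g \o f) comp_hcomp comp_diff.

End HomComp.

(* {0, 1, ..., 2n-2}, which is empty for n = 0. *)
Definition perv (n : nat) := 'I_(2 * n - 1).

(* The reverse of the usual order. *)
Definition pervle (n : nat) (p q : perv n) : bool := (q <= p)%N.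

Record coperverse (k : fieldType) (n : nat) := Coperverse {
  cop_obj :> perv n -> cdgaType k;
  cop_map : forall p q : perv n, pervle p q -> cdgaHom (cop_obj p) (cop_obj q);
  cop_map_id : forall p (pp : pervle p p), cop_map pp =1 id;
  cop_map_comp : forall p q r (pq : pervle p q) (qr : pervle q r)
    (pr : pervle p r), cop_map qr \o cop_map pq =1 cop_map pr }.
Arguments cop_map {k n} _ {p q}.

(* A linear section of B^p -> B^p / ker d^p, presented as the endomorphism
   [ker_sec] of B^p that it induces by precomposition with the projection;
   the values of [ker_sec] outside B^p are irrelevant. *)
Record ker_section (k : fieldType) (B : cdgaType k) (p : nat) := KerSection {
  ker_sec :> {linear B -> B};
  ker_sec_homog : forall x, x \in homog p -> ker_sec x \in homog p;
  ker_sec_ker : forall x, x \in homog p -> diff x = 0 -> ker_sec x = 0;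
  ker_secK : forall x, x \in homog p -> diff (ker_sec x - x) = 0 }.

Section Cotruncation.
Variables (k : fieldType) (B : cdgaType k) (p : nat) (s : ker_section B p).

(* C_p *)
Definition sec_image (c : B) : Prop := exists2 x, x \in homog p & c = s x.

(* B^r \otimes k[t] *)
Definition deg_poly (r : nat) (P : {poly B}) : Prop :=
  forall i, P`_i \in homog r.

(* B^(r-1) \otimes k[t], where B^(-1) = 0 *)
Definition deg_poly_pred (r : nat) (P : {poly B}) : Prop :=
  if r is r'.+1 then deg_poly r' P else P = 0.

(* The three cases r < p, r = p and r > p. *)
Definition cotrunc_deg (r : nat) (w : tdt B) : Prop :=
  deg_poly_pred r (dtpart w) /\ deg_poly r (tpart w) /\
  (if (r < p)%N then (tpart w)`_0 = 0
   else if r == p then sec_image (tpart w)`_0 else True).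

Definition cotrunc (w : tdt B) : Prop := forall r, cotrunc_deg r (hcomp r w).

(* For p = 0 the sum B^0 + (cotruncation) need not be direct: C_0 lies in B^0. *)
Definition unital_cotrunc (w : tdt B) : Prop :=
  exists2 b : B, b \in homog 0 & exists2 v, cotrunc v & w = Tdt b%:P 0 + v.

(* For p > 0 the unital cotruncation is closed under the differential and the
   product of B(t,dt) if and only if d vanishes on B^0 and C_p is stable under
   multiplication by B^0, i.e. the section is B^0-linear: for b in B^0 and c in
   C_p, the elements d b and b c have to lie again in the cotruncation.  Both
   conditions are automatic when B^0 = k: see [connected_diff0] and
   [connected_sec_linear]. *)
Definition sec_linear0 : Prop :=
  forall b x, b \in homog 0 -> x \in homog p -> s (b * x) = b * s x.

End Cotruncation.

Definition diff0_trivial (k : fieldType) (B : cdgaType k) : Prop :=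
  forall b : B, b \in homog 0 -> diff b = 0.

Definition connected (k : fieldType) (B : cdgaType k) : Prop :=
  forall b : B, b \in homog 0 -> exists c : k, b = c%:A.

Lemma diff1 (k : fieldType) (B : cdgaType k) : diff 1 = 0 :> B.
Proof.
have := diffM 1 (@hcomp1 k B); rewrite !mulr1 expr0 scale1r mul1r.
by move/eqP; rewrite -subr_eq0 opprD addNKr oppr_eq0 => /eqP.
Qed.

Lemma connected_diff0 (k : fieldType) (B : cdgaType k) :
  connected B -> diff0_trivial B.
Proof. by move=> cB b /cB[c ->]; rewrite linearZ /= diff1 scaler0. Qed.

Lemma connected_sec_linear (k : fieldType) (B : cdgaType k) p
  (s : ker_section B p) : connected B -> sec_linear0 s.
Proof.
move=> cB b x /cB[c ->] _.
by rewrite -!scalerAl !mul1r linearZ.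
Qed.

(* Pull-back of A --f--> B <--g-- C in the category of cdga's. *)
Record is_pullback (k : fieldType) (A B C P : cdgaType k) (f : cdgaHom A B)
    (g : cdgaHom C B) (a : cdgaHom P A) (c : cdgaHom P C) : Prop := IsPullback {
  pullback_comm : f \o a =1 g \o c;
  pullback_univ : forall (T : cdgaType k) (u : cdgaHom T A) (v : cdgaHom T C),
    f \o u =1 g \o v ->
    exists h : cdgaHom T P, [/\ a \o h =1 u, c \o h =1 v &
      forall h' : cdgaHom T P, a \o h' =1 u -> c \o h' =1 v -> h' =1 h] }.

(* (a, c) identifies P with { (x, y) | f x = g y }.  As a and c are morphisms,
   the product and the differential of P are then the componentwise ones. *)
Definition is_fibre_product (k : fieldType) (A B C P : cdgaType k)
    (f : cdgaHom A B) (g : cdgaHom C B) (a : cdgaHom P A) (c : cdgaHom P C) :=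
  injective (fun z => (a z, c z)) /\
  forall x y, f x = g y <-> exists z, a z = x /\ c z = y.

(* Main.v *)
(* A homogeneous section is idempotent on B^p, so that C_p = { c in B^p | s c = c }
   is decidable, and w = P + Q dt lies in the unital p-cotruncation if and only
   if its value P(0) at t = 0 has no component in the degrees strictly between 0
   and p and, when p > 0, a p-component in C_p.  As w |-> P(0) is a morphism, it
   suffices that these values form a sub-cdga of B; for p > 0 this needs d = 0 on
   B^0 and B^0 C_p <= C_p.  The condition gets weaker as p decreases.  Hence both
   the cotruncations, in B(t,dt), and the pull-backs, in A x B(t,dt), are monotone
   families of sub-cdga's of a fixed cdga, and their inclusions are the poset
   maps. *)
Require Import Defs.
From HB Require Import structures.
From mathcomp Require Import all_boot all_order all_algebra.

Set Implicit Arguments.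
Unset Strict Implicit.
Unset Printing Implicit Defensive.

Import GRing.Theory.
Local Open Scope ring_scope.

(** * Homogeneous components of differentials and products *)

Section HomogeneousComponents.
Variables (k : fieldType) (A : cdgaType k).
Implicit Types (x y : A) (m n r : nat).

(** Components of index at least [N] vanish: apply [hcomp] to the expansion of [x]. A bound that may
    be enlarged lets two elements be expanded over a common range. *)
Lemma hcomp_sum_ge x :
  exists N, forall M, (N <= M)%N -> x = \sum_(i < M) hcomp i x.
Proof.
have [N /eqP xE] := hcomp_sum x; exists N => M leNM; apply: hcomp_eq => n.
rewrite linear_sum /= {1}xE linear_sum /=.
rewrite (big_ord_widen _ (fun i => hcomp n (hcomp i x)) leNM) big_mkcond /=.
apply: eq_bigr => i _; case: ltnP => // leNi.
rewrite hcomp_proj; case: eqP => // _.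
rewrite xE linear_sum big1 // => j _ /=; rewrite hcomp_proj.
by case: eqP => // ij; have := ltn_ord j; rewrite -ij ltnNge leNi.
Qed.

Lemma hcomp_diffS n x : hcomp n.+1 (diff x) = diff (hcomp n x).
Proof.
have [N /eqP ->] := hcomp_sum x; rewrite !linear_sum; apply: eq_bigr => i _ /=.
rewrite (hcomp_homog n.+1 (diff_hcomp (hcompK i x))) hcomp_proj eqSS.
by case: eqP; rewrite ?linear0.
Qed.

(** Expand both factors up to a common [K > r]; in the row of index [i <= r] only the term with
    [j = r - i] has degree [r]. *)
Lemma hcomp_mul r x y :
  hcomp r (x * y) = \sum_(i < r.+1) hcomp i x * hcomp (r - i) y.
Proof.
have [M hM] := hcomp_sum_ge x; have [N hN] := hcomp_sum_ge y.
pose K := maxn (maxn M N) r.+1.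
have leK : [&& M <= K, N <= K & r.+1 <= K]%N by rewrite !leq_max !leqnn !orbT.
have /and3P[leMK leNK lerK] := leK.
rewrite {1}(hM K leMK) {1}(hN K leNK) big_distrlr linear_sum /=.
rewrite (big_ord_widen _ (fun i => hcomp i x * hcomp (r - i) y) lerK).
rewrite [RHS]big_mkcond /=; apply: eq_bigr => i _; rewrite linear_sum /=.
under eq_bigr do rewrite (hcomp_homog r (hcompM (hcompK _ _) (hcompK _ _))).
rewrite -big_mkcond ltnS /=; case: leqP => [leir|ltri]; last first.
  (* Rows with [i > r] contribute nothing, since [i + j = r] has no solution there. *)
  by rewrite big1 // => j /eqP rij; move: ltri; rewrite rij ltnNge leq_addr.
have ltK : (r - i < K)%N by rewrite (leq_ltn_trans (leq_subr _ _)).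
rewrite (big_pred1 (Ordinal ltK)) // => j /=.
by rewrite -(inj_eq val_inj) /= -{1}(subnKC leir) eqn_add2l eq_sym.
Qed.

End HomogeneousComponents.

(** * The product of two cdga's and its projections *)

Section Product.
Variables (k : fieldType) (A B : cdgaType k).
Implicit Types (x y : A * B) (m n : nat).

Definition prod_hcomp n x : A * B := (hcomp n x.1, hcomp n x.2).
Definition prod_diff x : A * B := (diff x.1, diff x.2).

Fact prod_hcomp_is_linear n : linear (prod_hcomp n).
Proof. by move=> c x y; rewrite /prod_hcomp !linearP. Qed.

Fact prod_hcomp_proj m n x :
  prod_hcomp m (prod_hcomp n x) = if m == n then prod_hcomp n x else 0.
Proof. by rewrite /prod_hcomp /= !hcomp_proj; case: eqP. Qed.

Lemma fst_sum I (s : seq I) (F : I -> A * B) :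
  (\sum_(i <- s) F i).1 = \sum_(i <- s) (F i).1.
Proof. exact: (raddf_sum (fst : {additive (A * B)%type -> A})). Qed.
Lemma snd_sum I (s : seq I) (F : I -> A * B) :
  (\sum_(i <- s) F i).2 = \sum_(i <- s) (F i).2.
Proof. exact: (raddf_sum (snd : {additive (A * B)%type -> B})). Qed.

Fact prod_hcomp_sum x : exists N, x == \sum_(i < N) prod_hcomp i x.
Proof.
have [M hM] := hcomp_sum_ge x.1; have [N hN] := hcomp_sum_ge x.2.
exists (maxn M N); rewrite -pair_eqE; apply/andP; split; apply/eqP.
  by rewrite fst_sum; apply: hM; rewrite leq_maxl.
by rewrite snd_sum; apply: hN; rewrite leq_maxr.
Qed.

Fact prod_hcomp1 : prod_hcomp 0 1 = 1.
Proof. by rewrite /prod_hcomp /= !hcomp1. Qed.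

Fact prod_hcompM m n x y : prod_hcomp m x = x -> prod_hcomp n y = y ->
  prod_hcomp (m + n)%N (x * y) = x * y.
Proof.
by case: x y => [x1 x2] [y1 y2] [h1 h2] [h3 h4]; congr (_, _); apply: hcompM.
Qed.

Fact prod_gcommM m n x y : prod_hcomp m x = x -> prod_hcomp n y = y ->
  x * y = (-1) ^+ (m * n)%N *: (y * x).
Proof.
by case: x y => [x1 x2] [y1 y2] [h1 h2] [h3 h4]; congr (_, _); apply: gcommM.
Qed.

Fact prod_diff_is_linear : linear prod_diff.
Proof. by move=> c x y; rewrite /prod_diff !linearP. Qed.

Fact prod_diff_hcomp n x : prod_hcomp n x = x ->
  prod_hcomp n.+1 (prod_diff x) = prod_diff x.
Proof. by case: x => [x1 x2] [h1 h2]; congr (_, _); apply: diff_hcomp. Qed.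

Fact prod_diffK x : prod_diff (prod_diff x) = 0.
Proof. by rewrite /prod_diff !diffK. Qed.

Fact prod_diffM n x y : prod_hcomp n x = x ->
  prod_diff (x * y) = prod_diff x * y + (-1) ^+ n *: (x * prod_diff y).
Proof.
by case: x y => [x1 x2] [y1 y2] [h1 h2]; congr (_, _); apply: diffM.
Qed.

HB.instance Definition _ := isCDGA.Build k (A * B)%type
  prod_hcomp_is_linear prod_hcomp_proj prod_hcomp_sum prod_hcomp1 prod_hcompM
  prod_gcommM prod_diff_is_linear prod_diff_hcomp prod_diffK prod_diffM.

HB.instance Definition _ := isCDGAHom.Build k (A * B)%type A fst
  (fun _ _ => erefl) (fun _ => erefl).
HB.instance Definition _ := isCDGAHom.Build k (A * B)%type B snd
  (fun _ _ => erefl) (fun _ => erefl).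

End Product.

(** * The morphism into a product induced by two morphisms *)

Section Pairing.
Variables (k : fieldType) (T A B : cdgaType k).
Variables (u : cdgaHom T A) (v : cdgaHom T B).

Definition pairing (z : T) : A * B := (u z, v z).

Fact pairing_is_linear : linear pairing.
Proof. by move=> c x y; rewrite /pairing !linearP. Qed.
Fact pairing_is_monoid_morphism : monoid_morphism pairing.
Proof. by split=> [|x y]; rewrite /pairing ?rmorph1 ?rmorphM. Qed.
Fact pairing_hcomp n z : pairing (hcomp n z) = hcomp n (pairing z).
Proof. by rewrite /pairing !hom_hcomp. Qed.
Fact pairing_diff z : pairing (diff z) = diff (pairing z).
Proof. by rewrite /pairing !hom_diff. Qed.

HB.instance Definition _ :=
  GRing.isLinear.Build k T (A * B)%type *:%R pairing pairing_is_linear.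
HB.instance Definition _ := GRing.isMonoidMorphism.Build T (A * B)%type pairing
  pairing_is_monoid_morphism.
HB.instance Definition _ := isCDGAHom.Build k T (A * B)%type pairing
  pairing_hcomp pairing_diff.

End Pairing.

(** * Sub-cdga's, their inclusions and factorizations through them *)

Record subcdga (k : fieldType) (A : cdgaType k) := SubCDGA {
  subcdga_mem :> {pred A};
  subcdga_closed : subalg_closed subcdga_mem;
  subcdga_hcomp : forall n x, x \in subcdga_mem -> hcomp n x \in subcdga_mem;
  subcdga_diff : forall x, x \in subcdga_mem -> diff x \in subcdga_mem }.

(** Membership is boolean, so elements with equal values are equal; this makes the inclusion
    injective. *)
Record subcdga_of (k : fieldType) (A : cdgaType k) (S : subcdga A) :=
  SubCDGAOf { subcdga_val : A; subcdga_valP : subcdga_val \in subcdga_mem S }.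

Section SubCDGA.
Variables (k : fieldType) (A : cdgaType k) (S : subcdga A).

HB.instance Definition _ := GRing.isSubalgClosed.Build k A (subcdga_mem S)
  (subcdga_closed S).

Local Notation sA := (subcdga_of S).
Implicit Types (x y : sA) (m n : nat).

HB.instance Definition _ := [isSub for @subcdga_val k A S].
HB.instance Definition _ := [Choice of sA by <:].
HB.instance Definition _ := [SubChoice_isSubAlgebra of sA by <:].

Definition sub_hcomp n x : sA := Sub (hcomp n (val x)) (subcdga_hcomp n (valP x)).
Definition sub_diff x : sA := Sub (diff (val x)) (subcdga_diff (valP x)).

Fact sub_hcomp_is_linear n : linear (sub_hcomp n).
Proof. by move=> c x y; apply: val_inj; rewrite /= !linearP. Qed.

Fact sub_hcomp_proj m n x :
  sub_hcomp m (sub_hcomp n x) = if m == n then sub_hcomp n x else 0.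
Proof. by apply: val_inj; rewrite /= hcomp_proj; case: eqP. Qed.

Fact sub_hcomp_sum x : exists N, x == \sum_(i < N) sub_hcomp i x.
Proof.
have [N /eqP xE] := hcomp_sum (val x); exists N; apply/eqP/val_inj.
by rewrite raddf_sum.
Qed.

Fact sub_hcomp1 : sub_hcomp 0 1 = 1.
Proof. by apply: val_inj; apply: hcomp1. Qed.

Fact sub_hcompM m n x y : sub_hcomp m x = x -> sub_hcomp n y = y ->
  sub_hcomp (m + n)%N (x * y) = x * y.
Proof.
move=> /(congr1 val) hx /(congr1 val) hy; apply: val_inj.
exact: hcompM hx hy.
Qed.

Fact sub_gcommM m n x y : sub_hcomp m x = x -> sub_hcomp n y = y ->
  x * y = (-1) ^+ (m * n)%N *: (y * x).
Proof.
move=> /(congr1 val) hx /(congr1 val) hy; apply: val_inj.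
exact: gcommM hx hy.
Qed.

Fact sub_diff_is_linear : linear sub_diff.
Proof. by move=> c x y; apply: val_inj; rewrite /= !linearP. Qed.

Fact sub_diff_hcomp n x : sub_hcomp n x = x ->
  sub_hcomp n.+1 (sub_diff x) = sub_diff x.
Proof. by move=> /(congr1 val) hx; apply: val_inj; apply: diff_hcomp. Qed.

Fact sub_diffK x : sub_diff (sub_diff x) = 0.
Proof. by apply: val_inj; rewrite /= diffK. Qed.

Fact sub_diffM n x y : sub_hcomp n x = x ->
  sub_diff (x * y) = sub_diff x * y + (-1) ^+ n *: (x * sub_diff y).
Proof.
move=> /(congr1 val) hx; apply: val_inj.
exact: diffM hx.
Qed.

HB.instance Definition _ := isCDGA.Build k sA
  sub_hcomp_is_linear sub_hcomp_proj sub_hcomp_sum sub_hcomp1 sub_hcompM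
  sub_gcommM sub_diff_is_linear sub_diff_hcomp sub_diffK sub_diffM.

Definition subcdga_incl (x : sA) : A := val x.
Fact subcdga_incl_is_linear : linear subcdga_incl.
Proof. by []. Qed.
Fact subcdga_incl_is_monoid_morphism : monoid_morphism subcdga_incl.
Proof. by []. Qed.
HB.instance Definition _ :=
  GRing.isLinear.Build k sA A *:%R subcdga_incl subcdga_incl_is_linear.
HB.instance Definition _ := GRing.isMonoidMorphism.Build sA A subcdga_incl
  subcdga_incl_is_monoid_morphism.
HB.instance Definition _ := isCDGAHom.Build k sA A subcdga_incl
  (fun _ _ => erefl) (fun _ => erefl).

Lemma subcdga_inclP w : w \in S <-> exists y, subcdga_incl y = w.
Proof.
split=> [wS|[y <-]]; last exact: valP.
by exists (Sub w wS); apply: SubK.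
Qed.

Section Lift.
Variables (T : cdgaType k) (u : cdgaHom T A) (uS : forall z, u z \in S).

(** This factorization supplies the poset maps as well as the projections and mediating morphisms of
    the pull-backs. *)
Definition subcdga_lift (z : T) : sA := Sub (u z) (uS z).

Fact subcdga_lift_is_linear : linear subcdga_lift.
Proof. by move=> c x y; apply: val_inj; rewrite /= !linearP. Qed.
Fact subcdga_lift_is_monoid_morphism : monoid_morphism subcdga_lift.
Proof. by split=> [|x y]; apply: val_inj; rewrite /= ?rmorph1 ?rmorphM. Qed.
Fact subcdga_lift_hcomp n z : subcdga_lift (hcomp n z) = hcomp n (subcdga_lift z).
Proof. by apply: val_inj; rewrite /= hom_hcomp. Qed.
Fact subcdga_lift_diff z : subcdga_lift (diff z) = diff (subcdga_lift z).
Proof. by apply: val_inj; rewrite /= hom_diff. Qed.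

HB.instance Definition _ :=
  GRing.isLinear.Build k T sA *:%R subcdga_lift subcdga_lift_is_linear.
HB.instance Definition _ := GRing.isMonoidMorphism.Build T sA subcdga_lift
  subcdga_lift_is_monoid_morphism.
HB.instance Definition _ := isCDGAHom.Build k T sA subcdga_lift
  subcdga_lift_hcomp subcdga_lift_diff.

End Lift.

End SubCDGA.

(** * Monotone families of sub-cdga's as coperverse cdga's *)

Section Filtered.
Variables (k : fieldType) (n : nat) (A : cdgaType k) (S : perv n -> subcdga A).
Hypothesis S_mono : forall p q : perv n, pervle p q -> {subset S p <= S q}.

Lemma incl_sub (p q : perv n) (pq : pervle p q) (y : subcdga_of (S p)) :
  subcdga_incl y \in S q.
Proof. by apply: (S_mono pq); apply: valP. Qed.

Definition filtered_map (p q : perv n) (pq : pervle p q) :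
    cdgaHom (subcdga_of (S p)) (subcdga_of (S q)) :=
  subcdga_lift (incl_sub pq).

Fact filtered_map_id p (pp : pervle p p) : filtered_map pp =1 id.
Proof. by move=> y; apply: val_inj. Qed.
Fact filtered_map_comp p q r (pq : pervle p q) (qr : pervle q r)
  (pr : pervle p r) : filtered_map qr \o filtered_map pq =1 filtered_map pr.
Proof. by move=> y; apply: val_inj. Qed.

Definition filtered_coperverse : coperverse k n :=
  Coperverse filtered_map_id filtered_map_comp.

End Filtered.

(** * The unital cotruncation as a sub-cdga of B(t,dt) *)

Section Cotruncation.
Variables (k : fieldType) (B : cdgaType k) (p : nat) (s : ker_section B p).
Implicit Types (b c : B) (w v : tdt B).

(** The difference [s x - x] is a cocycle of degree [p], so [s] kills it. *)
Lemma ker_sec_id x : x \in homog p -> s (s x) = s x.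
Proof.
move=> hx; have hsx := ker_sec_homog s hx.
apply/eqP; rewrite -subr_eq0 -linearB; apply/eqP/(ker_sec_ker s) => /=.
  by rewrite inE linearB /= (eqP hx) (eqP hsx).
exact: ker_secK.
Qed.

Lemma sec_imageP c : sec_image s c <-> c \in homog p /\ s c = c.
Proof.
split=> [[x hx ->]|[hc sc]]; last by exists c.
by rewrite ker_sec_id // ker_sec_homog.
Qed.

(* The values at t = 0 of the elements of the unital cotruncation: for p > 0,
   these are B^0 + C_p + B^(p+1) + B^(p+2) + ... *)
Definition cotrunc_const : {pred B} := [pred c |
  [forall r : 'I_p, (0 < r)%N ==> (hcomp r c == 0)] &&
  ((0 < p)%N ==> (s (hcomp p c) == hcomp p c))].

Lemma cotrunc_constP c : reflect
  ((forall r, (0 < r < p)%N -> hcomp r c = 0) /\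
   ((0 < p)%N -> s (hcomp p c) = hcomp p c))
  (c \in cotrunc_const).
Proof.
apply: (iffP andP) => -[h1 h2]; split.
- move=> r /andP[r0 rp]; have /forallP/(_ (Ordinal rp)) := h1.
  by rewrite r0 => /eqP.
- by move=> p0; move: h2; rewrite p0 => /eqP.
- by apply/forallP=> r; apply/implyP=> r0; rewrite h1 // r0 /=.
- by apply/implyP=> p0; rewrite h2.
Qed.

(** The degree conditions hold automatically for an [r]-component, which leaves only the condition
    on the constant coefficient. *)
Lemma cotrunc_degE r w : cotrunc_deg s r (hcomp r w) <->
  if (r < p)%N then hcomp r (tpart w)`_0 = 0
  else if r == p then sec_image s (hcomp r (tpart w)`_0) else True.
Proof.
have hr i (P : {poly B}) j : (map_poly (@hcomp k B i) P)`_j \in homog i.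
  by rewrite inE coef_map /= hcompK.
rewrite /cotrunc_deg /= coef_map /=.
split=> [[_ []] //|h]; split; first by case: (r) => //= r' i; apply: hr.
by split=> // i; apply: hr.
Qed.

(** Adding an element of B^0 changes only the degree 0 component of P(0). For [p = 0] the right-hand
    side is no restriction, because every x in B^0 is the sum of [x - s x] in B^0 and [s x] in
    C_0. *)
Lemma unital_cotruncE w : unital_cotrunc s w <-> (tpart w)`_0 \in cotrunc_const.
Proof.
have hcompS b r : b \in homog 0 -> (0 < r)%N -> hcomp r b = 0.
  by move=> /eqP hb r0; rewrite (hcomp_homog r hb) gtn_eqF.
split=> [[b hb [v hv ->]]|/cotrunc_constP[h1 h2]].
  apply/cotrunc_constP; rewrite /= coefD coefC /=; split=> [r /andP[r0 rp]|p0].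
    have /cotrunc_degE := hv r; rewrite rp linearD /= => ->.
    by rewrite hcompS ?addr0.
  have /cotrunc_degE := hv p; rewrite ltnn eqxx => /sec_imageP[_].
  by rewrite linearD /= (hcompS b) ?add0r.
set c := (tpart w)`_0 in h1 h2.
(* The constant to be split off: the remainder must have degree 0 component zero if [p > 0], and in
   C_0 if [p = 0]. *)
pose b : B := hcomp 0 c - (if p == 0%N then s (hcomp 0 c) else 0).
have p0E x : p = 0%N -> hcomp p x = hcomp 0 x by move->.
have hb : b \in homog 0.
  rewrite inE /b linearB /= hcompK; case: (eqVneq p 0%N) => [p0|_]; last first.
    by rewrite linear0.
  have := @ker_sec_homog _ _ _ s (hcomp 0 c).
  by rewrite !inE !p0E // hcompK eqxx => /(_ isT) /eqP ->.
exists b => //; exists (w - Tdt b%:P 0); last by rewrite addrC subrK.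
move=> r; apply/cotrunc_degE; rewrite /= coefD coefN coefC /= -/c linearB /=.
case: ltngtP => // [rp|rp].
  case: r rp => [|r] rp; last by rewrite h1 // (hcompS b) // subrr.
  by rewrite (eqP hb) /b gtn_eqF // subr0 subrr.
rewrite rp; have [p0|p0] := posnP p; last first.
  by rewrite (hcompS b) // subr0; apply/sec_imageP; rewrite inE hcompK h2.
exists (hcomp 0 c); first by rewrite p0 inE hcompK.
by rewrite !p0E // (eqP hb) /b {1}p0 eqxx opprB addrC subrK.
Qed.

Hypothesis hB0 : (0 < p)%N -> diff0_trivial B.
Hypothesis hs : (0 < p)%N -> sec_linear0 s.

(** In degrees strictly between 0 and [p], each term of [hcomp_mul] has a factor whose degree is
    also in that range, hence zero. In degree [p] only the two extreme terms survive, and both lie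
    in B^0 C_p. *)
Lemma cotrunc_constM b c : b \in cotrunc_const -> c \in cotrunc_const ->
  b * c \in cotrunc_const.
Proof.
move=> /cotrunc_constP[b1 b2] /cotrunc_constP[c1 c2].
apply/cotrunc_constP; split=> [r rp|p0].
  rewrite hcomp_mul big1 // => i _.
  have [i0|i0] := posnP i; first by rewrite i0 subn0 c1 // mulr0.
  rewrite b1 ?mul0r // i0 /=.
  by case/andP: rp => _ rp; apply: leq_ltn_trans rp; rewrite -ltnS.
have -> : hcomp p (b * c) = hcomp 0 b * hcomp p c + hcomp 0 c * hcomp p b.
  rewrite hcomp_mul -(prednK p0) big_ord_recl big_ord_recr /= subn0 subnn.
  rewrite big1 ?add0r => [|i _]; last first.
    by rewrite b1 ?mul0r //= -[X in (_ < X)%N](prednK p0) ltnS.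
  (* No sign arises from the exchange, as one factor has degree 0. *)
  congr (_ + _); rewrite (gcommM (hcompK _ _) (hcompK _ _)) muln0.
  by rewrite expr0 scale1r.
by rewrite linearD /= !(hs p0) ?inE ?hcompK // b2 // c2.
Qed.

Lemma cotrunc_const_subalg : subalg_closed cotrunc_const.
Proof.
split; last by move=> b c; apply: cotrunc_constM.
  apply/cotrunc_constP; split=> [r /andP[r0 _]|p0].
    by rewrite (hcomp_homog r hcomp1) gtn_eqF.
  by rewrite (hcomp_homog p hcomp1) gtn_eqF // linear0.
move=> a b c /cotrunc_constP[b1 b2] /cotrunc_constP[c1 c2].
apply/cotrunc_constP; split=> [r rp|p0].
  by rewrite linearP /= b1 // c1 // scaler0 addr0.
by rewrite !linearP /= b2 // c2.
Qed.

Lemma cotrunc_const_hcomp n c : c \in cotrunc_const ->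
  hcomp n c \in cotrunc_const.
Proof.
move=> /cotrunc_constP[c1 c2]; apply/cotrunc_constP; split=> [r rp|p0].
  by rewrite hcomp_proj; case: eqP => // <-; rewrite c1.
by rewrite hcomp_proj; case: eqP => [<-|_]; rewrite ?c2 ?linear0.
Qed.

(** All components of [diff c] in degrees 1 to [p] vanish: degree 1 because d is zero on B^0, the
    others because [c] has no component one degree lower. In degree [p] it remains that [s] maps 0
    to 0. *)
Lemma cotrunc_const_diff c : c \in cotrunc_const -> diff c \in cotrunc_const.
Proof.
move=> /cotrunc_constP[c1 _].
have d0 r : (0 < r <= p)%N -> hcomp r (diff c) = 0.
  case: r => // -[|r] /= rp; rewrite hcomp_diffS; last by rewrite c1 // linear0.
  by rewrite hB0 // inE hcompK.
apply/cotrunc_constP; split=> [r /andP[r0 rp]|p0].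
  by rewrite d0 // r0 ltnW.
by rewrite d0 ?linear0 // p0 leqnn.
Qed.

Definition cotrunc_mem : {pred tdt B} :=
  [pred w | (tpart w)`_0 \in cotrunc_const].

Fact cotrunc_mem_subalg : subalg_closed cotrunc_mem.
Proof.
have [h1 hD hM] := cotrunc_const_subalg.
split=> [|a v w|v w]; rewrite ?inE /=; first by rewrite coefC.
  by rewrite coefD coefZ -scalerAl mul1r; apply: hD.
by rewrite coef0M; apply: hM.
Qed.
Fact cotrunc_mem_hcomp n w : w \in cotrunc_mem -> hcomp n w \in cotrunc_mem.
Proof. by rewrite !inE /= coef_map; apply: cotrunc_const_hcomp. Qed.
Fact cotrunc_mem_diff w : w \in cotrunc_mem -> diff w \in cotrunc_mem.
Proof. by rewrite !inE /= coef_map; apply: cotrunc_const_diff. Qed.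

Definition cotrunc_subcdga : subcdga (tdt B) :=
  SubCDGA cotrunc_mem_subalg cotrunc_mem_hcomp cotrunc_mem_diff.

Lemma cotrunc_subcdgaP w : unital_cotrunc s w <-> w \in cotrunc_subcdga.
Proof. exact: unital_cotruncE. Qed.

End Cotruncation.

(** No compatibility of the sections is needed: for [0 < q < p] the [q]-component of P(0) is zero,
    so it lies in C_q for any section. *)
Lemma cotrunc_mem_lt (k : fieldType) (B : cdgaType k) (p q : nat)
    (sp : ker_section B p) (sq : ker_section B q) :
  (q < p)%N -> {subset cotrunc_mem sp <= cotrunc_mem sq}.
Proof.
move=> qp w; rewrite !inE => /cotrunc_constP[h1 _]; apply/cotrunc_constP.
split=> [r /andP[r0 rq]|q0]; first by rewrite h1 // r0 (ltn_trans rq).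
by rewrite h1 ?linear0 // q0.
Qed.

(** * Fibre products over a sub-cdga, and their universal property *)

Section FibreProduct.
Variables (k : fieldType) (A B C : cdgaType k).
Variables (f : cdgaHom A B) (g : cdgaHom C B) (S : subcdga C).

(** Cut out of [A * C] and not of the product of [A] with the carrier of [S], so that the pull-backs
    for varying [S] share one ambient cdga. *)
Definition fibre_mem : {pred A * C} :=
  [pred z | (f z.1 == g z.2) && (z.2 \in S)].

Fact fibre_subalg : subalg_closed fibre_mem.
Proof.
have [h1 hD hM] := subcdga_closed S.
split=> [|c v w|v w]; rewrite ?inE /= ?rmorph1 ?eqxx //.
  move=> /andP[/eqP e1 m1] /andP[/eqP e2 m2].
  by rewrite !linearP /= e1 e2 eqxx hD.
move=> /andP[/eqP e1 m1] /andP[/eqP e2 m2].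
by rewrite !rmorphM /= e1 e2 eqxx hM.
Qed.
Fact fibre_hcomp n z : z \in fibre_mem -> hcomp n z \in fibre_mem.
Proof.
rewrite !inE /= => /andP[/eqP e m].
by rewrite !hom_hcomp e eqxx subcdga_hcomp.
Qed.
Fact fibre_diff z : z \in fibre_mem -> diff z \in fibre_mem.
Proof.
by rewrite !inE /= => /andP[/eqP e m]; rewrite !hom_diff e eqxx subcdga_diff.
Qed.

Definition fibre_subcdga : subcdga (A * C)%type :=
  SubCDGA fibre_subalg fibre_hcomp fibre_diff.

Lemma fibre_sndP (z : subcdga_of fibre_subcdga) :
  (snd \o @subcdga_incl _ _ fibre_subcdga) z \in S.
Proof. by have /andP[] := valP z. Qed.

Definition fibre_fst : cdgaHom (subcdga_of fibre_subcdga) A :=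
  fst \o @subcdga_incl _ _ fibre_subcdga.
Definition fibre_snd : cdgaHom (subcdga_of fibre_subcdga) (subcdga_of S) :=
  subcdga_lift fibre_sndP.

Lemma fibre_is_fibre_product :
  is_fibre_product f (g \o @subcdga_incl _ _ S : cdgaHom (subcdga_of S) B)
    fibre_fst fibre_snd.
Proof.
split=> [z z' [e1 e2]|x y].
  by apply: val_inj; apply/eqP; rewrite -pair_eqE /= /pair_eq e1 e2 !eqxx.
split=> [e|[z [<- <-]]]; last by have /andP[/eqP] := valP z.
have m : (x, val y) \in fibre_subcdga by rewrite inE /= -[g _]e eqxx (valP y).
by exists (Sub (x, val y) m); split=> //; apply: val_inj.
Qed.

(** The mediating morphism is the pairing of [u] and [v], factored through the fibre product; joint
    injectivity of the projections makes it unique. *)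
Lemma fibre_is_pullback :
  is_pullback f (g \o @subcdga_incl _ _ S : cdgaHom (subcdga_of S) B)
    fibre_fst fibre_snd.
Proof.
have [inj fib] := fibre_is_fibre_product.
split=> [z|T u v e]; first by apply/fib; exists z.
have m z : pairing u (@subcdga_incl _ _ S \o v) z \in fibre_subcdga.
  by rewrite inE /= -[g _](e z) eqxx (valP (v z)).
exists (subcdga_lift m); split=> // [z|h' e1 e2 z]; first exact: val_inj.
apply: inj; congr (_, _); first exact: e1.
by rewrite [LHS]e2; apply: val_inj.
Qed.

End FibreProduct.

Theorem proposition3p0p1 (k : fieldType) (char0 : [pchar k] =i pred0)
    (n : nat) (A B : cdgaType k) (f : cdgaHom A B)
    (s : forall p : perv n, ker_section B p)
    (hB0 : (1 < n)%N -> diff0_trivial B)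
    (hs : forall p : perv n, (0 < p)%N -> sec_linear0 (s p)) :
  exists (X J : coperverse k n)
    (i : forall p : perv n, cdgaHom (X p) (tdt B))
    (a : forall p : perv n, cdgaHom (J p) A)
    (x : forall p : perv n, cdgaHom (J p) (X p)),
    [/\ (* X p is the unital cotruncation, as a sub-cdga of B(t,dt) *)
        forall p : perv n, injective (i p) /\
          forall w, unital_cotrunc (s p) w <-> exists y, i p y = w,
        forall (p q : perv n) (pq : pervle p q) y,
          i q (cop_map X pq y) = i p y,
        (* J p is the pull-back, with componentwise structure *)
        forall p : perv n,
          is_pullback f (@delta1 k B \o i p : cdgaHom (X p) B) (a p) (x p) /\
          is_fibre_product f (@delta1 k B \o i p : cdgaHom (X p) B) (a p) (x p)
      & (* the poset maps of J are induced by the inclusions *)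
        forall (p q : perv n) (pq : pervle p q) z,
          a q (cop_map J pq z) = a p z /\
          x q (cop_map J pq z) = cop_map X pq (x p z)].
Proof.
have Bp (p : perv n) : (0 < p)%N -> diff0_trivial B.
  (* A positive perversity forces [n > 1]: if [n <= 1], then [p < 2n - 1 <= 1]. *)
  move=> p0; apply: hB0; apply: contraTT p0; rewrite -!leqNgt => n1.
  rewrite -ltnS; apply: leq_trans (ltn_ord p) _.
  by rewrite leq_subLR (@leq_mul 2 n 2 1).
pose Xs p := cotrunc_subcdga (Bp p) (hs p).
pose Js p := fibre_subcdga f (@delta1 k B) (Xs p).
have Xmono (p q : perv n) : pervle p q -> {subset Xs p <= Xs q}.
  (* Equal perversities carry the same chosen section; otherwise [q < p] strictly. *)
  rewrite /pervle leq_eqVlt => /predU1P[/val_inj -> //|].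
  exact: cotrunc_mem_lt.
have Jmono (p q : perv n) : pervle p q -> {subset Js p <= Js q}.
  by move=> pq z /andP[e m]; apply/andP; split=> //; apply: Xmono pq _ m.
exists (filtered_coperverse Xmono), (filtered_coperverse Jmono).
exists (fun p => @subcdga_incl _ _ (Xs p)).
exists (fun p => fibre_fst f (@delta1 k B) (Xs p)).
exists (fun p => fibre_snd f (@delta1 k B) (Xs p)).
split=> [p|//|p|p q pq z].
- split=> [|w]; first exact: val_inj.
  exact: iff_trans (cotrunc_subcdgaP _ _ _) (subcdga_inclP _ _).
- by split; [apply: fibre_is_pullback | apply: fibre_is_fibre_product].
- by split=> //; apply: val_inj.
Qed.
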